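(* Let $\mathcal{C}$ be a clutter with a perfect matching $e_1,\ldots,e_g$ of König type. If for any two edges $f_1,f_2$ of $\mathcal{C}$ and for any $e_i$, one has $f_1\cap e_i\subset f_2\cap e_i$ or $f_2\cap e_i\subset f_1\cap e_i$, then $\mathcal{C}$ is unmixed.
   Context: A clutter $\mathcal{C}$ with finite vertex set $X=\{x_1,\ldots,x_n\}$ is a family $E(\mathcal{C})$ of subsets of $X$, called edges, none of which is included in another. The edge ideal $I(\mathcal{C})$ is the ideal of the polynomial ring $R=K[x_1,\ldots,x_n]$ over a field $K$ generated by the monomials $\prod_{x_i\in e}x_i$, $e\in E(\mathcal{C})$. A vertex cover of $\mathcal{C}$ is a subset of $X$ meeting every edge; it is minimal if no proper subset is a vertex cover. The height of $I(\mathcal{C})$ equals the minimum size of a vertex cover. $\mathcal{C}$ is unmixed if all its minimal vertex covers have the same size. A perfect matching of König type of $\mathcal{C}$ is a collection $e_1,\ldots,e_g$ of pairwise disjoint edges whose union is $X$ and such that $g$ is the height of $I(\mathcal{C})$. The symbol $\subset$ allows equality. *)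

(* Defs.v *)
From HB Require Import structures.
From mathcomp Require Import all_boot all_algebra.
From mathcomp Require Export ring_quotient mpoly.

Set Implicit Arguments.
Unset Strict Implicit.
Unset Printing Implicit Defensive.

Import GRing.Theory.
Local Open Scope ring_scope.

Section Height.
Variable R : comNzRingType.

(* A chain of primes Q_0 < ... < Q_h = P, of length h. *)
Definition prime_chain (h : nat) (P : prime_idealr R)
    (Q : 'I_h.+1 -> prime_idealr R) : Prop :=
  [/\ forall i j : 'I_h.+1, (i <= j)%N -> {subset Q i <= Q j},
      forall i j : 'I_h.+1, (i < j)%N -> exists2 f, f \in Q j & f \notin Q i
    & Q ord_max =i P].

(* Heights may be infinite, so they are given by relations with the natural
   numbers; a prime of infinite height is related to no number. *)
Definition prime_height (P : prime_idealr R) (h : nat) : Prop :=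
  (exists Q : 'I_h.+1 -> prime_idealr R, prime_chain P Q) /\
  (forall (k : nat) (Q : 'I_k.+1 -> prime_idealr R),
     prime_chain P Q -> (k <= h)%N).

Definition ideal_height (I : R -> Prop) (h : nat) : Prop :=
  (exists2 P : prime_idealr R, forall f, I f -> f \in P & prime_height P h) /\
  (forall (P : prime_idealr R) (k : nat),
     (forall f, I f -> f \in P) -> prime_height P k -> (h <= k)%N).

End Height.

Record clutter (n : nat) := Clutter {
  edges : {set {set 'I_n}};
  edges_antichain :
    forall e f : {set 'I_n}, e \in edges -> f \in edges -> e \subset f -> e = f
}.

Section Clutters.
Variable n : nat.
Implicit Types (C : clutter n) (T : {set 'I_n}).

Definition edge_monomial (K : fieldType) (e : {set 'I_n}) : {mpoly K[n]} :=
  \prod_(i in e) 'X_i.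

Definition edge_ideal (K : fieldType) C (f : {mpoly K[n]}) : Prop :=
  exists c : {set 'I_n} -> {mpoly K[n]},
    f = \sum_(e in edges C) c e * edge_monomial K e.

Definition vertex_cover C : pred {set 'I_n} :=
  fun T => [forall e in edges C, T :&: e != set0].

Definition minimal_vertex_cover C T : bool := minset (vertex_cover C) T.

Definition unmixed C : Prop :=
  forall T1 T2 : {set 'I_n},
    minimal_vertex_cover C T1 -> minimal_vertex_cover C T2 -> #|T1| = #|T2|.

Definition konig_perfect_matching (K : fieldType) C (g : nat)
    (e : 'I_g -> {set 'I_n}) : Prop :=
  [/\ forall i, e i \in edges C,
      forall i j, i != j -> [disjoint e i & e j],
      \bigcup_(i < g) e i = [set: 'I_n]
    & ideal_height (@edge_ideal K C) g].

End Clutters.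

(* Main.v *)
Require Import Defs.
From mathcomp Require Import all_boot all_algebra.

(** A minimal vertex cover [T] meets every edge [e i] of the matching. It cannot
    contain two vertices [x != y] of the same [e i]: by minimality there are
    edges [f1] and [f2] meeting [T] only in [x] and only in [y], so the traces of
    [f1] and [f2] on [e i] contain [x] but not [y], and [y] but not [x], and are
    incomparable. So [T] picks exactly one vertex from each of the [g] blocks
    [e i], which partition the vertex set, and [#|T| = g]. *)

(** Removing [x] from [T] leaves an edge uncovered; this private edge of [x]
    still meets [T], hence exactly in [x]. *)
Lemma minimal_cover_private_edge (n : nat) (C : clutter n) (T : {set 'I_n})
    (x : 'I_n) :
  minimal_vertex_cover C T -> x \in T ->
  exists2 f, f \in edges C & T :&: f = [set x].
Proof.
move=> /minsetP [/forall_inP covT minT] xT.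
have /forall_inPn [f fC /negPn Txf] : ~~ vertex_cover C (T :\ x).
  apply/negP => /minT /(_ (subsetDl _ _)) eqT.
  by move: xT; rewrite -eqT setD11.
exists f => //.
have Tf_x : T :&: f \subset [set x] by rewrite -setD_eq0 -setIDAC.
apply/eqP; rewrite eqEsubset Tf_x sub1set.
have /set0Pn [y yTf] := covT f fC.
by rewrite -(set1P (subsetP Tf_x y yTf)).
Qed.

(** Private edges of two distinct vertices of [T :&: d] would have incomparable
    traces on [d]. *)
Lemma minimal_cover_meets_once (n : nat) (C : clutter n) (T d : {set 'I_n}) :
  (forall f1 f2 : {set 'I_n}, f1 \in edges C -> f2 \in edges C ->
     f1 :&: d \subset f2 :&: d \/ f2 :&: d \subset f1 :&: d) ->
  d \in edges C -> minimal_vertex_cover C T -> #|T :&: d| = 1.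
Proof.
move=> cmp dC minT.
have /minsetP [/forall_inP covT _] := minT.
apply/eqP; rewrite eqn_leq card_gt0 covT // andbT.
apply/card_le1_eqP => y x /setIP [yT yd] /setIP [xT xd].
have [f1 f1C Tf1] := minimal_cover_private_edge _ _ _ _ minT xT.
have [f2 f2C Tf2] := minimal_cover_private_edge _ _ _ _ minT yT.
have xf1 : x \in f1 by have := set11 x; rewrite -Tf1 => /setIP [].
have yf2 : y \in f2 by have := set11 y; rewrite -Tf2 => /setIP [].
case: (cmp f1 f2 f1C f2C) => /subsetP sub12.
- have /setIP [xf2 _] : x \in f2 :&: d by apply: sub12; rewrite inE xf1.
  by apply/set1P; rewrite -Tf2 inE xT.
- have /setIP [yf1 _] : y \in f1 :&: d by apply: sub12; rewrite inE yf2.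
  by apply/esym/set1P; rewrite -Tf1 inE yT.
Qed.

Theorem theorem2p13 (K : fieldType) (n : nat) (C : clutter n)
    (g : nat) (e : 'I_g -> {set 'I_n})
    (He : konig_perfect_matching K C e)
    (Hcmp : forall f1 f2 : {set 'I_n}, f1 \in edges C -> f2 \in edges C ->
       forall i : 'I_g,
         f1 :&: e i \subset f2 :&: e i \/ f2 :&: e i \subset f1 :&: e i) :
  unmixed C.
Proof.
case: He => eC disj_e cover_e _.
suff card_min T : minimal_vertex_cover C T -> #|T| = g.
  by move=> T1 T2 /card_min -> /card_min ->.
move=> minT.
have disj_Te i j : i != j -> [disjoint T :&: e i & T :&: e j].
  move=> /disj_e; apply: disjointW; exact: subsetIr.
rewrite -[T]setIT -cover_e big_distrr /= -sum1_card.
rewrite (partition_disjoint_bigcup _ _ disj_Te).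
rewrite (eq_bigr (fun=> 1)) ?sum1_card ?card_ord // => i _.
rewrite sum1_card; apply: (minimal_cover_meets_once _ _ _ _ _ (eC i) minT).
by move=> f1 f2 f1C f2C; apply: Hcmp.
Qed.
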